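(* Let $(M^n,g,\nabla f,\lambda,\mu)$ be a compact gradient hyperbolic Yamabe soliton with $\lambda\neq 0$ such that $\pounds_{\nabla f}\pounds_{\nabla f}g$ is trace-free and divergence-free. If $n>2$, then the soliton is trivial, i.e., $\pounds_{\nabla f}g=0$.
   Context: $(M^n,g)$ is a smooth $n$-dimensional Riemannian manifold, $f$ is a smooth real function on $M$, $\nabla f$ its gradient, and $r$ is the scalar curvature of $(M,g)$. For a vector field $\xi$, $\pounds_\xi g$ is the Lie derivative of $g$ in the direction of $\xi$, and $\pounds_\xi\pounds_\xi g:=\pounds_\xi(\pounds_\xi g)$. A hyperbolic Yamabe soliton $(M,g,\xi,\lambda,\mu)$ consists of $(M,g)$, a smooth vector field $\xi$ (the potential vector field) and two real scalars (constants) $\lambda,\mu$ such that $\pounds_\xi\pounds_\xi g+\lambda\pounds_\xi g=(\mu-r)g$. It is gradient if $\xi=\nabla f$. It is called trivial if $\xi$ is a Killing vector field, i.e., $\pounds_\xi g=0$. Trace and divergence of symmetric $(0,2)$-tensor fields are taken with respect to $g$ and its Levi-Civita connection; trace-free (divergence-free) means that the trace (divergence) vanishes identically. *)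

(* Defs.v *)
From HB Require Import structures.
From mathcomp Require Import all_boot all_order all_algebra.
From mathcomp Require Import all_classical all_reals all_analysis.

Set Implicit Arguments.
Unset Strict Implicit.
Unset Printing Implicit Defensive.

Import Order.TTheory GRing.Theory Num.Theory.
Import numFieldNormedType.Exports.

Local Open Scope classical_set_scope.
Local Open Scope ring_scope.

Definition partial (R : realType) (n : nat) (a : 'I_n)
    (F : 'rV[R]_n -> R) (x : 'rV[R]_n) : R :=
  'D_(delta_mx 0 a) F x.

(* [F] is C^(k+1) on the open set [U] when it is (Frechet-)differentiable at
   every point of [U] and its partial derivatives are C^k on [U]. *)
Fixpoint Ck_on (R : realType) (n k : nat) (U : set 'rV[R]_n)
    (F : 'rV[R]_n -> R) : Prop :=
  match k with
  | 0 => forall x, U x -> {for x, continuous F}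
  | k'.+1 => (forall x, U x -> differentiable F x) /\
             (forall a : 'I_n, Ck_on k' U (partial a F))
  end.

Definition smooth_on (R : realType) (n : nat) (U : set 'rV[R]_n)
    (F : 'rV[R]_n -> R) : Prop :=
  forall k : nat, Ck_on k U F.

(* A smooth n-manifold without boundary, given by a smooth atlas.  Charts and
   their inverses are total functions; their values outside [chart_dom i],
   resp. [chart_cod i], are irrelevant. *)
Record manifold (R : realType) (n : nat) := Manifold {
  carrier :> topologicalType;
  atlas : Type;
  chart_dom : atlas -> set carrier;
  chart_cod : atlas -> set 'rV[R]_n;
  chart : atlas -> carrier -> 'rV[R]_n;
  chart_inv : atlas -> 'rV[R]_n -> carrier;
  carrier_hausdorff : hausdorff_space carrier;
  carrier_second_countable : @second_countable carrier;
  atlas_cover : forall p : carrier, exists i, chart_dom i p;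
  chart_dom_open : forall i, open (chart_dom i);
  chart_cod_open : forall i, open (chart_cod i);
  chart_in_cod : forall i p, chart_dom i p -> chart_cod i (chart i p);
  chart_inv_in_dom : forall i x, chart_cod i x -> chart_dom i (chart_inv i x);
  chartK : forall i p, chart_dom i p -> chart_inv i (chart i p) = p;
  chart_invK : forall i x, chart_cod i x -> chart i (chart_inv i x) = x;
  chart_continuous : forall i, {within chart_dom i, continuous (chart i)};
  chart_inv_continuous :
    forall i, {within chart_cod i, continuous (chart_inv i)};
  transition_smooth : forall (i j : atlas) (c : 'I_n),
    smooth_on [set x | chart_cod i x /\ chart_dom j (chart_inv i x)]
      (fun x => chart j (chart_inv i x) 0 c)
}.

Arguments chart_dom {R n m}.
Arguments chart_cod {R n m}.
Arguments chart {R n m}.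
Arguments chart_inv {R n m}.

Section Fields.
Context {R : realType} {n : nat} (M : manifold R n).

Definition overlap (i j : atlas M) : set 'rV[R]_n :=
  [set x | chart_cod i x /\ chart_dom j (chart_inv i x)].

Definition transition (i j : atlas M) (x : 'rV[R]_n) : 'rV[R]_n :=
  chart j (chart_inv i x).

(* The (a, c) entry is the partial derivative in the direction a of the c-th
   component of the transition map (the convention of the library's ['J]). *)
Definition transition_jacobian (i j : atlas M) (x : 'rV[R]_n) : 'M[R]_n :=
  \matrix_(a, c) partial a (fun y => transition i j y 0 c) x.

(* Fields are given by their components in all the charts.  Only the values on
   [chart_cod i] matter: equations between fields are always stated there. *)
Notation vector_components := (atlas M -> 'rV[R]_n -> 'rV[R]_n).
Notation tensor2_components := (atlas M -> 'rV[R]_n -> 'M[R]_n).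

Record smooth_function := SmoothFunction {
  sf_fun :> M -> R;
  sf_smooth : forall i : atlas M,
    smooth_on (chart_cod i) (fun x => sf_fun (chart_inv i x))
}.

Record vector_field := VectorField {
  vf_comp :> vector_components;
  vf_smooth : forall (i : atlas M) (c : 'I_n),
    smooth_on (chart_cod i) (fun x => vf_comp i x 0 c);
  vf_transform : forall (i j : atlas M) (x : 'rV[R]_n), overlap i j x ->
    vf_comp j (transition i j x) = vf_comp i x *m transition_jacobian i j x
}.

Record riemannian_metric := RiemannianMetric {
  metric_comp :> tensor2_components;
  metric_smooth : forall (i : atlas M) (a b : 'I_n),
    smooth_on (chart_cod i) (fun x => metric_comp i x a b);
  metric_transform : forall (i j : atlas M) (x : 'rV[R]_n), overlap i j x ->
    metric_comp i x =
      transition_jacobian i j x *m metric_comp j (transition i j x)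
        *m (transition_jacobian i j x)^T;
  metric_sym : forall (i : atlas M) (x : 'rV[R]_n), chart_cod i x ->
    (metric_comp i x)^T = metric_comp i x;
  metric_pos : forall (i : atlas M) (x v : 'rV[R]_n), chart_cod i x ->
    v != 0 -> 0 < (v *m metric_comp i x *m v^T) 0 0
}.

(* (L_xi h)_ab = xi^c d_c h_ab + h_cb d_a xi^c + h_ac d_b xi^c *)
Definition lie_derivative (xi : vector_components) (h : tensor2_components) :
    tensor2_components :=
  fun i x => \matrix_(a, b)
    \sum_c (xi i x 0 c * partial c (fun y => h i y a b) x
            + h i x c b * partial a (fun y => xi i y 0 c) x
            + h i x a c * partial b (fun y => xi i y 0 c) x).

Section Metric.
Variable g : riemannian_metric.

Definition ginv (i : atlas M) (x : 'rV[R]_n) : 'M[R]_n := invmx (g i x).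

(* (grad f)^c = g^ca d_a f *)
Definition gradient (f : smooth_function) : vector_components :=
  fun i x => \row_c
    \sum_a ginv i x c a * partial a (fun y => f (chart_inv i y)) x.

(* Gamma^c_ab = 1/2 g^cd (d_a g_bd + d_b g_ad - d_d g_ab) *)
Definition christoffel (i : atlas M) (c a b : 'I_n) (x : 'rV[R]_n) : R :=
  2^-1 * \sum_d ginv i x c d *
    (partial a (fun y => g i y b d) x + partial b (fun y => g i y a d) x
     - partial d (fun y => g i y a b) x).

(* Ric_bc = d_a Gamma^a_bc - d_b Gamma^a_ac
            + Gamma^a_ae Gamma^e_bc - Gamma^a_be Gamma^e_ac;
   with this sign, round spheres have positive Ricci curvature. *)
Definition ricci : tensor2_components :=
  fun i x => \matrix_(b, c)
    \sum_a (partial a (christoffel i a b c) x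
            - partial b (christoffel i a a c) x
            + \sum_e (christoffel i a a e x * christoffel i e b c x
                      - christoffel i a b e x * christoffel i e a c x)).

Definition trace (h : tensor2_components) (i : atlas M) (x : 'rV[R]_n) : R :=
  \sum_a \sum_b ginv i x a b * h i x a b.

Definition scalar_curvature : atlas M -> 'rV[R]_n -> R := trace ricci.

(* (nabla_c h)_ab = d_c h_ab - Gamma^d_ca h_db - Gamma^d_cb h_ad *)
Definition covariant_derivative (h : tensor2_components)
    (i : atlas M) (c a b : 'I_n) (x : 'rV[R]_n) : R :=
  partial c (fun y => h i y a b) x
  - \sum_d (christoffel i d c a x * h i x d b
            + christoffel i d c b x * h i x a d).

(* (div h)_b = g^ca (nabla_c h)_ab *)
Definition divergence (h : tensor2_components) : vector_components :=
  fun i x => \row_b \sum_c \sum_a ginv i x c a * covariant_derivative h i c a b x.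

Definition trace_free (h : tensor2_components) : Prop :=
  forall (i : atlas M) (x : 'rV[R]_n), chart_cod i x -> trace h i x = 0.

Definition divergence_free (h : tensor2_components) : Prop :=
  forall (i : atlas M) (x : 'rV[R]_n), chart_cod i x -> divergence h i x = 0.

Definition is_gradient_of (xi : vector_field) (f : smooth_function) : Prop :=
  forall (i : atlas M) (x : 'rV[R]_n), chart_cod i x -> xi i x = gradient f i x.

Definition hyperbolic_yamabe_soliton (xi : vector_field) (lambda mu : R) : Prop :=
  forall (i : atlas M) (x : 'rV[R]_n), chart_cod i x ->
    lie_derivative xi (lie_derivative xi g) i x
      + lambda *: lie_derivative xi g i x
    = (mu - scalar_curvature i x) *: g i x.

Definition is_killing (xi : vector_field) : Prop :=
  forall (i : atlas M) (x : 'rV[R]_n), chart_cod i x ->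
    lie_derivative xi g i x = 0.

End Metric.
End Fields.

(* Main.v *)
(** Let [h = L_xi g] and let [T = tr_g h] (that is, [2 div xi]). Differentiating
    the trace along [xi] gives [xi(T) = tr_g (L_xi h) - |h|_g^2], and the first
    term vanishes by hypothesis. At a maximum or a minimum of [T] on the compact
    manifold [dT = 0], so [h = 0] and hence [T = 0] there; thus [T] vanishes
    identically, and so does [|h|_g^2 = - xi(T)]. No integration is needed.
    That [T] is a well-defined function on the manifold rests on the symmetry of
    the second derivatives of the transition maps. *)

Require Import Defs.
From HB Require Import structures.
From mathcomp Require Import all_boot all_order all_algebra.
From mathcomp Require Import all_classical all_reals all_analysis.
From mathcomp Require Import ring.

Set Implicit Arguments.
Unset Strict Implicit.
Unset Printing Implicit Defensive.

Import Order.TTheory GRing.Theory Num.Theory.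
Import numFieldNormedType.Exports.
Local Open Scope classical_set_scope.
Local Open Scope ring_scope.

(** * Symmetry of second derivatives *)

Section DirectionalDerivatives.
Context {R : realType} {V : normedModType R}.
Implicit Types (F : V -> R) (v w x y : V).

Lemma is_derive_along_line F y v (t : R) :
  differentiable F (y + t *: v) ->
  is_derive t 1 (fun s : R => F (y + s *: v)) ('D_v F (y + t *: v)).
Proof.
move=> /(@diff_derivable _ _ _ _ _ v) dF.
have E : (fun h : R => h^-1 *: (F (y + (h *: (1 : R) + t) *: v) - F (y + t *: v)))
    = (fun h : R => h^-1 *: (F (h *: v + (y + t *: v)) - F (y + t *: v))).
  by apply/funext => h; rewrite [_%:A]mulr1 scalerDl addrCA.
by apply: DeriveDef; rewrite /derivable /derive /= E.
Qed.

Lemma directional_MVT F y v (s : R) : 0 < s ->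
  (forall t, t \in `[0, s]%R -> differentiable F (y + t *: v)) ->
  exists2 t, t \in `]0, s[%R &
    F (y + s *: v) - F y = 'D_v F (y + t *: v) * s.
Proof.
move=> s0 dF.
pose g : R -> R := fun t => F (y + t *: v).
have dg t : t \in `[0, s]%R -> is_derive t 1 g ('D_v F (y + t *: v)).
  by move=> /dF; exact: is_derive_along_line.
have cg : {within `[0, s], continuous g}.
  by apply: derivable_within_continuous => t /dg[].
have dgo t : t \in `]0, s[%R -> is_derive t 1 g ('D_v F (y + t *: v)).
  by move=> /subset_itv_oo_cc /dg.
have [t tI e] := MVT s0 dgo cg.
by exists t => //; rewrite -[s in RHS]subr0 -e /g scale0r addr0.
Qed.

(** The second difference over a parallelogram is the increment along [v] of a first difference
    along [w], so the mean value theorem applies twice, first along [v] and then along [w]. Its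
    value does not change when [v] and [w] are exchanged, which is the source of the symmetry of
    second derivatives. *)
Lemma second_difference_MVT (U : set V) F v w x (s : R) : 0 < s ->
  (forall y, U y -> differentiable F y) ->
  (forall y, U y -> differentiable ('D_v F) y) ->
  (forall t u : R, t \in `[0, s]%R -> u \in `[0, s]%R ->
    U (x + t *: v + u *: w)) ->
  exists t u, [/\ t \in `[0, s]%R, u \in `[0, s]%R &
    F (x + s *: v + s *: w) - F (x + s *: v) - (F (x + s *: w) - F x)
      = 'D_w ('D_v F) (x + t *: v + u *: w) * s * s].
Proof.
move=> s0 dF dDF sU.
have I0 : (0 : R) \in `[0, s]%R by rewrite in_itv /= lexx ltW.
have Is : s \in `[0, s]%R by rewrite in_itv /= lexx ltW.
pose Fs y := F (y + s *: w); pose G : V -> R := Fs - F.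
have dFs y : U (y + s *: w) -> differentiable Fs y.
  move=> Uy; have -> : Fs = F \o (id + cst (s *: w)) by [].
  by apply: differentiable_comp; [exact: differentiableD|exact: dF].
have DFs y : 'D_v Fs y = 'D_v F (y + s *: w).
  by rewrite /derive; under eq_fun do rewrite /Fs /= -addrA.
have Ut t : t \in `[0, s]%R -> U (x + t *: v).
  by move=> /sU /(_ I0); rewrite scale0r addr0.
have dG t : t \in `[0, s]%R -> differentiable G (x + t *: v).
  by move=> tI; apply: differentiableB; [exact/dFs/sU|exact/dF/Ut].
have [t /subset_itv_oo_cc tI eG] := directional_MVT s0 dG.
have DG : 'D_v G (x + t *: v) =
    'D_v F (x + t *: v + s *: w) - 'D_v F (x + t *: v).
  by rewrite deriveB ?DFs //; apply: diff_derivable;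
    [exact/dFs/sU|exact/dF/Ut].
have [u /subset_itv_oo_cc uI eDF] :=
  directional_MVT s0 (fun u uI => dDF _ (sU _ u tI uI)).
by exists t, u; split=> //; rewrite -eDF -DG -eG /G /Fs.
Qed.

(** On an arbitrarily small parallelogram at [x], the same second difference is a value of each
    mixed derivative times [s * s]. So the two mixed derivatives take a common value at two points
    near [x], and continuity at [x] brings them within any [e] of each other. *)
Lemma derive_comm (U : set V) F v w x : open U -> U x ->
  (forall y, U y -> differentiable F y) ->
  (forall y, U y -> differentiable ('D_v F) y) ->
  (forall y, U y -> differentiable ('D_w F) y) ->
  {for x, continuous ('D_w ('D_v F))} ->
  {for x, continuous ('D_v ('D_w F))} ->
  'D_w ('D_v F) x = 'D_v ('D_w F) x.
Proof.
move=> oU Ux dF dvF dwF cwv cvw.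
apply/eqP; rewrite -subr_eq0 -normr_le0; apply/ler_addgt0Pl => e e0.
rewrite addr0.
have e20 : 0 < e / 2 by rewrite divr_gt0.
have nwv : \forall y \near x, `|'D_w ('D_v F) x - 'D_w ('D_v F) y| < e / 2.
  by move/cvgrPdist_lt : cwv => /(_ _ e20).
have nvw : \forall y \near x, `|'D_v ('D_w F) x - 'D_v ('D_w F) y| < e / 2.
  by move/cvgrPdist_lt : cvw => /(_ _ e20).
have nU : \forall y \near x, U y by exact: open_nbhs_nbhs.
have /nbhs_ballP[r /= r0 rU] : \forall y \near x, U y /\
    (`|'D_w ('D_v F) x - 'D_w ('D_v F) y| < e / 2 /\
     `|'D_v ('D_w F) x - 'D_v ('D_w F) y| < e / 2).
  exact: filterI nU (filterI nwv nvw).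
(* With this side length the parallelogram has all its points within [r / 2] of [x]; the summand 1
   keeps the denominator positive even if [v] and [w] vanish. *)
pose s := r / 2 / (`|v| + `|w| + 1).
have d0 : 0 < `|v| + `|w| + 1 by rewrite ltr_wpDl // addr_ge0.
have s0 : 0 < s by rewrite !divr_gt0.
have near_x (t u : R) : t \in `[0, s]%R -> u \in `[0, s]%R ->
    ball x r (x + t *: v + u *: w).
  rewrite !in_itv /= => /andP[t0 ts] /andP[u0 us].
  rewrite -ball_normE /= -addrA opprD addNKr normrN.
  apply: (le_lt_trans (ler_normD _ _)); rewrite !normrZ !ger0_norm //.
  apply: (@le_lt_trans _ _ (s * (`|v| + `|w| + 1))).
    rewrite mulrDr mulr1 mulrDr; apply: ler_wpDr; first exact: ltW.
    by apply: lerD; apply: ler_wpM2r.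
  by rewrite /s divfK ?gt_eqF // ltr_pdivrMr // ltr_pMr // ltr1n.
have sU t u : t \in `[0, s]%R -> u \in `[0, s]%R -> U (x + t *: v + u *: w).
  by move=> tI uI; case: (rU _ (near_x t u tI uI)).
have sU' t u : t \in `[0, s]%R -> u \in `[0, s]%R -> U (x + t *: w + u *: v).
  by move=> tI uI; rewrite addrAC; exact: sU.
have [t [u [tI uI E1]]] := second_difference_MVT s0 dF dvF sU.
have [u' [t' [uI' tI' E2]]] := second_difference_MVT s0 dF dwF sU'.
have [_ [Hwv _]] := rU _ (near_x t u tI uI).
have [_ [_ Hvw]] := rU _ (near_x t' u' tI' uI').
have E : 'D_w ('D_v F) (x + t *: v + u *: w) =
         'D_v ('D_w F) (x + t' *: v + u' *: w).
  rewrite [x + t' *: v + _]addrAC.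
  apply: (mulIf (lt0r_neq0 s0)); apply: (mulIf (lt0r_neq0 s0)).
  apply: etrans (esym E1) (etrans _ E2).
  by rewrite (addrAC x (s *: w)); ring.
apply: le_trans (ler_distD ('D_w ('D_v F) (x + t *: v + u *: w)) _ _) _.
rewrite (splitr e); apply: lerD; first exact: (ltW Hwv).
by rewrite E distrC (ltW Hvw).
Qed.

End DirectionalDerivatives.

(** * Derivatives of matrix-valued maps *)

Section MatrixDerivatives.
Context {R : realType} {V : normedModType R}.
Implicit Types (v x : V).

(** The zero map is the differential. This is what makes differentiability a local property in the
    next lemma, where it is applied to the difference of two functions that agree near [x]. *)
Lemma near0_differentiable (F : V -> R) x :
  (\forall y \near x, F y = 0) -> differentiable F x.
Proof.
move=> F0.
have c0 : continuous (\0 : {linear V -> R}) by move=> y; exact: cvg_cst.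
have E : F \o shift x = cst (F x) + (\0 : {linear V -> R}) +o_ 0 id.
  apply/eqaddoP => e e0; have Fx : F x = 0 by exact: nbhs_singleton F0.
  have : \forall y \near x, F y = 0 by [].
  rewrite (near_shift 0) subr0 /=; apply: filterS => y Fy.
  by rewrite !fctE /= Fy Fx /cst addr0 subr0 normr0 mulr_ge0 // (ltW e0).
by apply/diff_locallyP; rewrite (diff_unique c0 E).
Qed.

Lemma near_eq_differentiable (F G : V -> R) x :
  (\forall y \near x, F y = G y) -> differentiable F x -> differentiable G x.
Proof.
move=> FG dF; rewrite -(subrK F G); apply: differentiableD => //.
apply: near0_differentiable; apply: filterS FG => y FGy.
by rewrite -[LHS]/(G y - F y) FGy subrr.
Qed.

Lemma differentiable_bigsum (I : Type) (r : seq I) (P : pred I)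
    (F : I -> V -> R) x : (forall i, differentiable (F i) x) ->
  differentiable (fun y => \sum_(i <- r | P i) F i y) x.
Proof.
move=> dF; elim: r => [|i r IH].
  by under eq_fun do rewrite big_nil; exact: differentiable_cst.
under eq_fun do rewrite big_cons.
by case: (P i) ; first exact: differentiableD.
Qed.

Lemma derive_bigsum (I : Type) (r : seq I) (F : I -> V -> R) v x :
  (forall i, differentiable (F i) x) ->
  'D_v (fun y => \sum_(i <- r) F i y) x = \sum_(i <- r) 'D_v (F i) x.
Proof.
move=> dF; elim: r => [|i r IH].
  by under eq_fun do rewrite big_nil; rewrite big_nil derive_cst.
under eq_fun do rewrite big_cons.
rewrite big_cons -IH -deriveD //; apply: diff_derivable => //.
exact: differentiable_bigsum.
Qed.

Lemma differentiable_bigprod (I : Type) (r : seq I) (F : I -> V -> R) x :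
  (forall i, differentiable (F i) x) ->
  differentiable (fun y => \prod_(i <- r) F i y) x.
Proof.
move=> dF; elim: r => [|i r IH].
  by under eq_fun do rewrite big_nil; exact: differentiable_cst.
by under eq_fun do rewrite big_cons; exact: differentiableM.
Qed.

Definition mx_differentiable m n (A : V -> 'M[R]_(m, n)) x :=
  forall i j, differentiable (fun y => A y i j) x.

Definition mx_derive m n v (A : V -> 'M[R]_(m, n)) x : 'M[R]_(m, n) :=
  \matrix_(i, j) 'D_v (fun y => A y i j) x.

Lemma mx_differentiableM m n p (A : V -> 'M[R]_(m, n)) (B : V -> 'M[R]_(n, p))
    x : mx_differentiable A x -> mx_differentiable B x ->
  mx_differentiable (fun y => A y *m B y) x.
Proof.
move=> dA dB i j; under eq_fun do rewrite mxE.
by apply: differentiable_bigsum => k; exact: differentiableM.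
Qed.

Lemma mx_differentiable_tr m n (A : V -> 'M[R]_(m, n)) x :
  mx_differentiable A x -> mx_differentiable (fun y => (A y)^T) x.
Proof. by move=> dA i j; under eq_fun do rewrite mxE; exact: dA. Qed.

Lemma mx_deriveM m n p (A : V -> 'M[R]_(m, n)) (B : V -> 'M[R]_(n, p)) v x :
  mx_differentiable A x -> mx_differentiable B x ->
  mx_derive v (fun y => A y *m B y) x =
  mx_derive v A x *m B x + A x *m mx_derive v B x.
Proof.
move=> dA dB; apply/matrixP => i j; rewrite !mxE.
under eq_fun do rewrite mxE.
rewrite derive_bigsum => [|k]; last exact: differentiableM.
rewrite -big_split /=; apply: eq_bigr => k _; rewrite !mxE.
rewrite (@deriveM _ _ (fun y => A y i k) (fun y => B y k j)).
- by rewrite addrC; congr (_ + _); exact: mulrC.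
- exact/diff_derivable/dA.
- exact/diff_derivable/dB.
Qed.

Lemma mx_derive_tr m n (A : V -> 'M[R]_(m, n)) v x :
  mx_derive v (fun y => (A y)^T) x = (mx_derive v A x)^T.
Proof. by apply/matrixP => i j; rewrite !mxE; under eq_fun do rewrite mxE. Qed.

Lemma mx_derive_near_eq m n (A B : V -> 'M[R]_(m, n)) v x :
  (\forall y \near x, A y = B y) -> mx_derive v A x = mx_derive v B x.
Proof.
move=> AB; apply/matrixP => i j; rewrite !mxE.
by apply: near_eq_derive; apply: filterS AB => y ->.
Qed.

Lemma mx_derive_cst m n (A : 'M[R]_(m, n)) v x : mx_derive v (cst A) x = 0.
Proof. by apply/matrixP => i j; rewrite !mxE derive_cst. Qed.

Lemma derive_trace n (A : V -> 'M[R]_n) v x : mx_differentiable A x ->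
  'D_v (fun y => \tr (A y)) x = \tr (mx_derive v A x).
Proof.
by move=> dA; rewrite /mxtrace derive_bigsum //; apply: eq_bigr => i; rewrite mxE.
Qed.

Lemma differentiable_det n (A : V -> 'M[R]_n) x :
  mx_differentiable A x -> differentiable (fun y => \det (A y)) x.
Proof.
move=> dA; apply: differentiable_bigsum => s.
apply: differentiableM; first exact: differentiable_cst.
by apply: differentiable_bigprod => i; exact: dA.
Qed.

Lemma mx_differentiable_adj n (A : V -> 'M[R]_n) x :
  mx_differentiable A x -> mx_differentiable (fun y => \adj (A y)) x.
Proof.
move=> dA i j; under eq_fun do rewrite mxE /cofactor.
apply: differentiableM; first exact: differentiable_cst.
apply: differentiable_det => k l.
by under eq_fun do rewrite !mxE; exact: dA.
Qed.

(** By the adjugate formula the entries are rational in those of [A]. As [invmx] returns its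
    argument on singular matrices, the formula is used only on a neighbourhood where [A] is
    invertible. *)
Lemma mx_differentiable_inv n (A : V -> 'M[R]_n) x :
  (\forall y \near x, A y \in unitmx) -> mx_differentiable A x ->
  mx_differentiable (fun y => invmx (A y)) x.
Proof.
move=> uA dA i j.
have d : differentiable (fun y => (\det (A y))^-1 * \adj (A y) i j) x.
  apply: differentiableM; last exact: mx_differentiable_adj.
  apply: differentiableV; first exact: differentiable_det.
  by rewrite -unitfE; exact: nbhs_singleton uA.
apply: near_eq_differentiable d.
by apply: filterS uA => y uAy; rewrite /invmx uAy [RHS]mxE.
Qed.

(** Differentiate the locally constant product of [invmx (A y)] and [A y], then solve for the
    derivative of the first factor. *)
Lemma mx_derive_inv n (A : V -> 'M[R]_n) v x :
  (\forall y \near x, A y \in unitmx) -> mx_differentiable A x ->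
  mx_derive v (fun y => invmx (A y)) x =
  - (invmx (A x) *m mx_derive v A x *m invmx (A x)).
Proof.
move=> uA dA; have uAx : A x \in unitmx by exact: nbhs_singleton uA.
have : mx_derive v (fun y => invmx (A y) *m A y) x = 0.
  rewrite -[RHS](mx_derive_cst 1%:M v x); apply: mx_derive_near_eq.
  by apply: filterS uA => y; exact: mulVmx.
rewrite mx_deriveM //; last exact: mx_differentiable_inv.
move=> /(congr1 (fun B => B *m invmx (A x))) /eqP.
by rewrite /= mul0mx mulmxDl mulmxK // addr_eq0 => /eqP ->.
Qed.

End MatrixDerivatives.

(** * Partial derivatives and the chain rule in coordinates *)

Section Coordinates.
Context {R : realType}.

Lemma derive_partial n (F : 'rV[R]_n -> R) (v x : 'rV[R]_n) :
  differentiable F x -> 'D_v F x = \sum_c v 0 c * partial c F x.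
Proof.
move=> dF; rewrite (deriveE v dF) {1}(row_sum_delta v) linear_sum.
by apply: eq_bigr => c _; rewrite linearZ /partial (deriveE _ dF).
Qed.

Lemma mx_derive_row m n (A : 'rV[R]_n -> 'rV[R]_m) (v x : 'rV[R]_n) :
  mx_differentiable A x ->
  mx_derive v A x = v *m \matrix_(a, c) partial a (fun y => A y 0 c) x.
Proof.
move=> dA; apply/rowP => c; rewrite !mxE (derive_partial v (dA 0 c)).
by apply: eq_bigr => a _; rewrite mxE.
Qed.

Lemma differentiable_row (V : normedModType R) n (A : V -> 'rV[R]_n) (x : V) :
  mx_differentiable A x -> differentiable A x.
Proof.
move=> dA; have -> : A = \sum_(c < n) (fun y => A y 0 c *: delta_mx 0 c).
  by apply/funext => y; rewrite fct_sumE -row_sum_delta.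
by apply: differentiable_sum => c; apply: differentiableZl; exact: dA.
Qed.

Lemma derive_comp_row (V : normedModType R) n (A : V -> 'rV[R]_n)
    (F : 'rV[R]_n -> R) (v x : V) :
  mx_differentiable A x -> differentiable F (A x) ->
  'D_v (fun y => F (A y)) x = 'D_(mx_derive v A x) F (A x).
Proof.
move=> dA dF; have dAx := differentiable_row dA.
rewrite (_ : mx_derive v A x = 'D_v A x); last first.
  by rewrite derive_mx //; exact: diff_derivable.
have dFA : differentiable (F \o A) x by exact: differentiable_comp.
rewrite [LHS](deriveE v dFA) (deriveE _ dF) (deriveE v dAx).
by rewrite (diff_comp dAx dF).
Qed.

Lemma smooth_differentiable n (U : set 'rV[R]_n) (F : 'rV[R]_n -> R) x :
  smooth_on U F -> U x -> differentiable F x.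
Proof. by move=> /(_ 1)[dF _]; exact: dF. Qed.

Lemma smooth_partial n (U : set 'rV[R]_n) (F : 'rV[R]_n -> R) a :
  smooth_on U F -> smooth_on U (partial a F).
Proof. by move=> sF k; have [_] := sF k.+1; exact. Qed.

Lemma partialC n (U : set 'rV[R]_n) (F : 'rV[R]_n -> R) a b x :
  open U -> smooth_on U F -> U x ->
  partial a (partial b F) x = partial b (partial a F) x.
Proof.
move=> oU sF Ux; apply: (derive_comm oU Ux) => [y Uy|y Uy|y Uy||].
- exact: smooth_differentiable sF Uy.
- by apply: smooth_differentiable Uy; exact: smooth_partial.
- by apply: smooth_differentiable Uy; exact: smooth_partial.
- exact: (smooth_partial a (smooth_partial b sF) 0%N x Ux).
- exact: (smooth_partial b (smooth_partial a sF) 0%N x Ux).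
Qed.

End Coordinates.

(** * Vanishing of directional derivatives at a local maximum *)

Section LocalMaximum.
Context {R : realType} {V : normedModType R}.

(** Restricting [F] to the line through [x] in direction [v] reduces this to Fermat's criterion for
    a function of one variable at the interior point 0. *)
Lemma derive_local_max (F : V -> R) (v x : V) :
  (\forall y \near x, differentiable F y) ->
  (\forall y \near x, F y <= F x) -> 'D_v F x = 0.
Proof.
move=> dF maxF.
have clv : (x + t *: v) @[t --> (0 : R)] --> x.
  rewrite -[X in _ --> X]addr0 -(scale0r v).
  by apply: cvgD; [exact: cvg_cst|apply: cvgZl; exact: cvg_id].
have : \forall t \near (0 : R),
    differentiable F (x + t *: v) /\ F (x + t *: v) <= F x.
  exact: clv (filterI dF maxF).
move=> /nbhs_ballP[e /= e0 He].
have {}He t : t \in `]-e, e[%R ->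
    differentiable F (x + t *: v) /\ F (x + t *: v) <= F x.
  rewrite in_itv /= => te; apply: He.
  by rewrite -ball_normE /= sub0r normrN ltr_norml.
pose g : R -> R := fun t => F (x + t *: v).
have dg t : t \in `]-e, e[%R -> is_derive t 1 g ('D_v F (x + t *: v)).
  by move=> /He[dFt _]; exact: is_derive_along_line.
have I0 : (0 : R) \in `]-e, e[%R by rewrite in_itv /= oppr_lt0 e0.
have g0 : g 0 = F x by rewrite /g scale0r addr0.
have dg1 t : t \in `]-e, e[%R -> derivable g t 1 by case/dg.
have gmax t : t \in `]-e, e[%R -> g t <= g 0 by move=> /He[_]; rewrite g0.
have le_e : - e <= e by rewrite ltW // gtrN.
have [_] := derive1_at_max le_e dg1 I0 gmax.
by have [_] := dg 0 I0; rewrite scale0r addr0 => <-.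
Qed.

End LocalMaximum.

(** * Positive definite matrices *)

Section PositiveDefinite.
Context {R : rcfType}.

Lemma posdef_unitmx n (A : 'M[R]_n) :
  (forall v : 'rV[R]_n, v != 0 -> 0 < (v *m A *m v^T) 0 0) -> A \in unitmx.
Proof.
move=> pA; rewrite -row_free_unit; apply: inj_row_free => v vA0.
apply/eqP/negPn/negP => /pA.
by rewrite vA0 mul0mx mxE ltxx.
Qed.

(** Cholesky factorization, by induction on the size: split off the first row and column and factor
    the Schur complement, which is again symmetric and positive definite. *)
Lemma posdef_factor n (A : 'M[R]_n) : A^T = A ->
  (forall v : 'rV[R]_n, v != 0 -> 0 < (v *m A *m v^T) 0 0) ->
  exists P : 'M[R]_n, A = P *m P^T.
Proof.
elim: n A => [|n IH] A; first by exists 0; rewrite [LHS]flatmx0 flatmx0.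
rewrite -[n.+1]/(1 + n)%N in A * => symA pA.
pose a := A 0 0; pose b := @ursubmx _ 1 n 1 n A; pose C := @drsubmx _ 1 n 1 n A.
have eA : A = block_mx a%:M b b^T C.
  rewrite -[LHS]submxK; congr block_mx; last first.
    by rewrite /b trmx_ursub symA.
  by rewrite [LHS]mx11_scalar !mxE lshift0.
(* The corner entry is the value of the quadratic form at the first basis vector. *)
have a0 : 0 < a.
  have := pA (row_mx 1%:M 0); rewrite {1}eA mul_row_block !mul1mx !mul0mx !addr0.
  rewrite tr_row_mx mul_row_col trmx1 trmx0 mulmx0 mulmx1 addr0 mxE eqxx.
  apply; apply/eqP => /(congr1 lsubmx); rewrite row_mxKl linear0.
  by move/matrixP/(_ 0 0)/eqP; rewrite !mxE oner_eq0.
pose S := C - a^-1 *: (b^T *m b).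
have symC : C^T = C by rewrite /C trmx_drsub symA.
have symS : S^T = S.
  by rewrite /S linearB linearZ /= trmx_mul trmxK symC.
have pS (v : 'rV[R]_n) : v != 0 -> 0 < (v *m S *m v^T) 0 0.
  (* This [u] completes the square: the first block of [row_mx u v *m A] vanishes, so the form of
     [A] at [row_mx u v] equals the form of [S] at [v]. *)
  move=> v0; pose u : 'M[R]_1 := - (a^-1 *: (v *m b^T)).
  have /pA : row_mx u v != 0.
    by move: v0; apply: contra_neq => /(congr1 rsubmx); rewrite row_mxKr linear0.
  rewrite {1}eA mul_row_block tr_row_mx mul_row_col.
  rewrite mul_mx_scalar {1}/u scalerN scalerA divff ?gt_eqF // scale1r addNr.
  rewrite mul0mx add0r; congr (0 < (_ *m _) 0 0).
  rewrite /u /S mulmxBr addrC mulNmx; congr (_ - _).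
  by rewrite -scalemxAr -scalemxAl mulmxA.
have [Q eS] := IH _ symS pS.
pose s := Num.sqrt a.
have ss : s * s = a by rewrite -expr2 sqr_sqrtr // ltW.
have s0 : s != 0 by rewrite gt_eqF // sqrtr_gt0.
(* Multiplying this block lower triangular matrix by its transpose gives [a], [b], [b^T] and, in the
   last block, [a^-1 *: (b^T *m b) + S], which is [C]. *)
exists (block_mx s%:M 0 (s^-1 *: b^T) Q).
rewrite eA tr_block_mx mulmx_block !trmx0 !mulmx0 !mul0mx !addr0.
rewrite tr_scalar_mx -scalar_mxM ss linearZ /= trmxK.
rewrite mul_scalar_mx mul_mx_scalar !scalerA divff // !scale1r.
congr block_mx; rewrite -eS /S -scalemxAl -scalemxAr scalerA -invfM ss.
by rewrite addrC subrK.
Qed.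

Lemma trace_mul_tr_eq0 m n (B : 'M[R]_(m, n)) : \tr (B *m B^T) = 0 -> B = 0.
Proof.
have -> : \tr (B *m B^T) = \sum_i \sum_j B i j ^+ 2.
  by apply: eq_bigr => i _; rewrite mxE; apply: eq_bigr => j _; rewrite mxE.
move=> /eqP; rewrite psumr_eq0 => [/allP B0|i _]; last first.
  by apply: sumr_ge0 => j _; exact: sqr_ge0.
apply/matrixP => i j; rewrite mxE; apply/eqP; rewrite -sqrf_eq0.
have := B0 i (mem_index_enum i); rewrite /= psumr_eq0 => [/allP Bi0|k _].
  exact: Bi0 j (mem_index_enum j).
exact: sqr_ge0.
Qed.

(** The trace is the squared norm of [h] with respect to [A]. In a frame where [A = P *m P^T]
    becomes the identity, [h] becomes the symmetric matrix [k], and cyclicity turns the trace into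
    the sum of the squares of the entries of [k]. *)
Lemma posdef_trace_sq_eq0 n (A h : 'M[R]_n) : A^T = A ->
  (forall v : 'rV[R]_n, v != 0 -> 0 < (v *m A *m v^T) 0 0) -> h^T = h ->
  \tr (invmx A *m h *m invmx A *m h) = 0 -> h = 0.
Proof.
move=> symA pA symh.
have uA := posdef_unitmx pA; have [P eA] := posdef_factor symA pA.
have uP : P \in unitmx.
  by move: uA; rewrite eA !unitmxE det_mulmx det_tr unitrM => /andP[].
have uPt : P^T \in unitmx by rewrite unitmx_tr.
pose k := invmx P *m h *m (invmx P)^T.
have eh : h = P *m k *m P^T.
  by rewrite /k !mulmxA mulmxV // mul1mx trmx_inv mulmxKV.
have eAi : invmx A = (invmx P)^T *m invmx P.
  apply: (can_inj (mulKmx uA)); rewrite mulmxV // eA -mulmxA.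
  by rewrite (mulmxA P^T) trmx_inv mulmxV // mul1mx mulmxV.
have symk : k^T = k by rewrite /k !trmx_mul trmxK symh mulmxA.
have -> : \tr (invmx A *m h *m invmx A *m h) = \tr (k *m k^T).
  rewrite symk [in RHS]/k eAi !mulmxA.
  by rewrite -!mulmxA [LHS]mxtrace_mulC !mulmxA.
by move=> /trace_mul_tr_eq0 k0; rewrite eh k0 mulmx0 mul0mx.
Qed.

End PositiveDefinite.

(** * Algebra of metric traces *)

Section TraceIdentities.
Context {R : comUnitRingType} {n : nat}.
Implicit Types A B G h : 'M[R]_n.

(** A change of chart acts on both tensors by congruence, so this is the chart independence of the
    metric trace. The inner factors [J] cancel, and cyclicity removes the outer ones. *)
Lemma trace_congruence (J A h : 'M[R]_n) : J \in unitmx -> A \in unitmx ->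
  \tr (invmx (J *m A *m J^T) *m (J *m h *m J^T)) = \tr (invmx A *m h).
Proof.
move=> uJ uA; have uJt : J^T \in unitmx by rewrite unitmx_tr.
have -> : invmx (J *m A *m J^T) = invmx J^T *m invmx A *m invmx J.
  have uM : J *m A *m J^T \in unitmx by rewrite !unitmx_mul uJ uA.
  apply: (can_inj (mulKmx uM)); rewrite mulmxV // !mulmxA mulmxK //.
  by rewrite mulmxK // mulmxV.
by rewrite -!mulmxA mulKmx // mxtrace_mulC !mulmxA mulmxK.
Qed.

(* With [dG], [dh] the derivatives of the components of [G] and [h] along a
   field whose Jacobian is [B]: the [B]-terms of the two Lie derivatives
   cancel in the derivative of the [G]-trace of [h]. *)
Lemma trace_lie_product G h B dG dh : G \in unitmx ->
  h = dG + B *m G + G *m B^T ->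
  \tr (- (invmx G *m dG *m invmx G) *m h + invmx G *m dh) =
  \tr (invmx G *m (dh + B *m h + h *m B^T))
    - \tr (invmx G *m h *m invmx G *m h).
Proof.
move=> uG eh; have -> : dG = h - B *m G - G *m B^T.
  by rewrite [in RHS]eh [X in X - _]addrAC addrK addrK.
rewrite !mulmxBr !mulmxBl !mulmxDr !mulmxA mulmxK // mulVmx // mul1mx.
rewrite [\tr (_ + invmx G *m h *m B^T)]mxtraceD.
have trN (X : 'M[R]_n) : \tr (- X) = - \tr X by exact: raddfN.
have trB (X Y : 'M[R]_n) : \tr (X - Y) = \tr X - \tr Y by exact: raddfB.
have -> : \tr (invmx G *m h *m B^T) = \tr (B^T *m invmx G *m h).
  by rewrite mxtrace_mulC mulmxA.
by rewrite mulNmx !mulmxBl !mxtraceD trN !trB; ring.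
Qed.

End TraceIdentities.

(** * Charts, overlaps and transition maps *)

Section Manifold.
Context {R : realType} {n : nat} {M : manifold R n}.
Implicit Types (i j : atlas M) (x : 'rV[R]_n).

Lemma chart_dom_nbhs i (p : M) : chart_dom i p -> nbhs p (chart_dom i).
Proof. by move=> ?; apply: open_nbhs_nbhs; split=> //; exact: chart_dom_open. Qed.

Lemma chart_cod_nbhs i x : chart_cod i x -> nbhs x (chart_cod i).
Proof. by move=> ?; apply: open_nbhs_nbhs; split=> //; exact: chart_cod_open. Qed.

Lemma chart_cts i (p : M) : chart_dom i p -> {for p, continuous (chart i)}.
Proof.
move=> ip; have := @chart_continuous _ _ M i.
rewrite continuous_open_subspace; last exact: chart_dom_open.
by apply; rewrite inE.
Qed.

Lemma chart_inv_cts i x : chart_cod i x -> {for x, continuous (chart_inv i)}.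
Proof.
move=> ix; have := @chart_inv_continuous _ _ M i.
rewrite continuous_open_subspace; last exact: chart_cod_open.
by apply; rewrite inE.
Qed.

Lemma overlap_open i j : open (overlap i j).
Proof.
rewrite openE => x [ix jx]; apply: filterI; first exact: chart_cod_nbhs.
exact: (chart_inv_cts ix (chart_dom_nbhs jx)).
Qed.

Lemma overlap_nbhs i j x : overlap i j x -> nbhs x (overlap i j).
Proof. by move=> ?; apply: open_nbhs_nbhs; split=> //; exact: overlap_open. Qed.

Lemma transition_in_cod i j x : overlap i j x -> chart_cod j (transition i j x).
Proof. by move=> [_ jx]; exact: chart_in_cod. Qed.

Lemma transition_differentiable i j x : overlap i j x ->
  mx_differentiable (transition i j) x.
Proof.
move=> o a c; rewrite (ord1 a).
exact: smooth_differentiable (transition_smooth i j c) o.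
Qed.

Lemma jacobian_differentiable i j x : overlap i j x ->
  mx_differentiable (transition_jacobian i j) x.
Proof.
move=> o a c; under eq_fun do rewrite mxE.
apply: smooth_differentiable o; apply: smooth_partial.
exact: (transition_smooth i j c).
Qed.

Lemma mx_derive_transition i j v x : overlap i j x ->
  mx_derive v (transition i j) x = v *m transition_jacobian i j x.
Proof. by move=> o; exact: mx_derive_row (transition_differentiable o). Qed.

(** Chain rule: passing to the chart [j] pushes the direction [v] forward. When [v] is [xi i x], the
    new direction is [xi j] at the image point. *)
Lemma mx_derive_comp_transition i j m p (A : 'rV[R]_n -> 'M[R]_(m, p)) v x :
  overlap i j x -> mx_differentiable A (transition i j x) ->
  mx_derive v (fun y => A (transition i j y)) x =
  mx_derive (v *m transition_jacobian i j x) A (transition i j x).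
Proof.
move=> o dA; apply/matrixP => a b; rewrite !mxE -mx_derive_transition //.
apply: (derive_comp_row v (F := fun y => A y a b)) => //.
exact: transition_differentiable.
Qed.

End Manifold.

(** * The trace of the Lie derivative of the metric *)

Section TraceOfLieDerivative.
Context {R : realType} {n : nat} {M : manifold R n}.
Variables (g : riemannian_metric M) (xi : vector_field M).
Implicit Types (i j : atlas M) (x : 'rV[R]_n).

Local Notation Lg := (lie_derivative xi g).

Definition field_jacobian i x : 'M[R]_n :=
  \matrix_(a, c) partial a (fun y => xi i y 0 c) x.

Lemma vf_differentiable i x : chart_cod i x -> mx_differentiable (xi i) x.
Proof.
by move=> ix a c; rewrite (ord1 a); exact: smooth_differentiable (vf_smooth xi i c) ix.
Qed.

Lemma metric_differentiable i x : chart_cod i x -> mx_differentiable (g i) x.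
Proof.
by move=> ix a b; exact: smooth_differentiable (metric_smooth g i a b) ix.
Qed.

Lemma metric_unitmx i x : chart_cod i x -> g i x \in unitmx.
Proof. by move=> ix; apply: posdef_unitmx => v; exact: metric_pos. Qed.

Lemma lie_metric_differentiable i x : chart_cod i x ->
  mx_differentiable (Lg i) x.
Proof.
move=> ix a b; under eq_fun do rewrite mxE.
have dg c d := metric_differentiable ix c d.
have dxi c := vf_differentiable ix 0 c.
have dpg c d e : differentiable (partial c (fun y => g i y d e)) x.
  by apply: smooth_differentiable ix; apply: smooth_partial; exact: metric_smooth.
have dpxi c d : differentiable (partial c (fun y => xi i y 0 d)) x.
  by apply: smooth_differentiable ix; apply: smooth_partial; exact: vf_smooth.
apply: differentiable_bigsum => c; apply: differentiableD; last first.
  exact: differentiableM (dg _ _) (dpxi _ _).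
by apply: differentiableD; exact: differentiableM.
Qed.

(** Differentiability of the entries of [h] allows the sum of partial derivatives weighted by [xi]
    to be collected into one directional derivative. In this matrix form, products and traces can be
    handled without indices. *)
Lemma lie_derivativeE (h : atlas M -> 'rV[R]_n -> 'M[R]_n) i x :
  mx_differentiable (h i) x ->
  lie_derivative xi h i x = mx_derive (xi i x) (h i) x
    + field_jacobian i x *m h i x + h i x *m (field_jacobian i x)^T.
Proof.
move=> dh; apply/matrixP => a b; rewrite !mxE !big_split /=.
rewrite derive_partial //; congr (_ + _ + _).
  by apply: eq_bigr => c _; rewrite mxE mulrC.
by apply: eq_bigr => c _; rewrite !mxE.
Qed.

Lemma lie_metric_sym i x : chart_cod i x -> (Lg i x)^T = Lg i x.
Proof.
move=> ix; rewrite lie_derivativeE; last exact: metric_differentiable.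
rewrite !linearD /= !trmx_mul trmxK Defs.metric_sym // addrAC; congr (_ + _ + _).
rewrite -mx_derive_tr; apply: mx_derive_near_eq.
by apply: filterS (chart_cod_nbhs ix) => y; exact: Defs.metric_sym.
Qed.

(** The transformation law writes the invertible matrix [g i x] as a product with the Jacobian as a
    factor, so the inverse transition map need not be differentiated. *)
Lemma jacobian_unitmx i j x : overlap i j x ->
  transition_jacobian i j x \in unitmx.
Proof.
move=> o; have [ix _] := o; have := metric_unitmx ix.
by rewrite (metric_transform _ o) !unitmx_mul => /andP[/andP[]].
Qed.

(* The second derivatives of the transition map in the derivative of
   [xi j = xi i *m J] are those of [J] along [xi], because partial derivatives
   commute. *)
Lemma field_jacobian_transform i j x : overlap i j x ->
  transition_jacobian i j x *m field_jacobian j (transition i j x) =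
  field_jacobian i x *m transition_jacobian i j x
    + mx_derive (xi i x) (transition_jacobian i j) x.
Proof.
move=> o; have [ix _] := o; have jy := transition_in_cod o.
set J := transition_jacobian i j.
have dJ := jacobian_differentiable o.
have dxi := vf_differentiable ix.
apply/row_matrixP => a.
have : mx_derive (delta_mx 0 a) (fun z => xi j (transition i j z)) x =
    mx_derive (delta_mx 0 a) (fun z => xi i z *m J z) x.
  apply: mx_derive_near_eq; apply: filterS (overlap_nbhs o) => z.
  exact: vf_transform.
rewrite (mx_derive_comp_transition _ o (vf_differentiable jy)).
rewrite (mx_deriveM _ dxi dJ) (mx_derive_row _ (vf_differentiable jy)).
rewrite (mx_derive_row _ dxi) -!mulmxA -rowE => ->.
rewrite linearD /= -rowE; congr (_ + _).
apply/rowP => d; rewrite [LHS]mxE [RHS]mxE [RHS]mxE.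
rewrite (derive_partial _ (dJ a d)); apply: eq_bigr => c _; congr (_ * _).
rewrite [LHS]mxE.
have JE b : (fun y => J y b d) = partial b (fun y => transition i j y 0 d).
  by apply/funext => y; rewrite mxE.
rewrite -/(partial a _) !JE.
exact: (partialC _ _ (@overlap_open _ _ _ i j) (transition_smooth i j d) o).
Qed.

(** Differentiating the transformation law of [g] along [xi] produces two terms with the derivative
    [K] of the Jacobian. The same two terms come from the non-tensorial part of
    [field_jacobian_transform] on the other side. *)
Lemma lie_metric_transform i j x : overlap i j x ->
  Lg i x = transition_jacobian i j x *m Lg j (transition i j x)
    *m (transition_jacobian i j x)^T.
Proof.
move=> o; have [ix _] := o; have jy := transition_in_cod o.
rewrite !lie_derivativeE; try exact: metric_differentiable.
have dgj := metric_differentiable jy.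
have dJ := jacobian_differentiable o.
have dgt : mx_differentiable (fun z => g j (transition i j z)) x.
  move=> a b; have dt := differentiable_row (transition_differentiable o).
  exact: differentiable_comp dt (dgj a b).
have Jtr := field_jacobian_transform o.
have -> : mx_derive (xi i x) (g i) x = mx_derive (xi i x) (fun z =>
    transition_jacobian i j z *m g j (transition i j z)
      *m (transition_jacobian i j z)^T) x.
  apply: mx_derive_near_eq; apply: filterS (overlap_nbhs o) => z.
  exact: metric_transform.
rewrite mx_deriveM; last 2 first.
- exact: mx_differentiableM.
- exact: mx_differentiable_tr.
rewrite mx_deriveM // mx_derive_tr mx_derive_comp_transition //.
rewrite -(vf_transform _ o) (metric_transform _ o).
move: Jtr; set J := transition_jacobian i j x; set Bj := field_jacobian j _.
set Bi := field_jacobian i x; set K := mx_derive _ _ x.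
set G := g j _; set dG := mx_derive _ _ _ => Jtr.
rewrite !mulmxDr !mulmxDl !mulmxA Jtr.
have -> : J *m G *m Bj^T *m J^T = J *m G *m (Bi *m J + K)^T.
  by rewrite -Jtr trmx_mul !mulmxA.
rewrite linearD /= trmx_mul !mulmxDl !mulmxDr !mulmxA.
move: (K *m G *m J^T) (J *m dG *m J^T) (J *m G *m K^T) (Bi *m _ *m _ *m _) => a b c d.
move: (J *m _ *m _ *m _) => e.
by apply/matrixP => r s; rewrite !mxE; ring.
Qed.

(** The index sum in [trace] is the matrix trace against the transpose of [h]; symmetry of [g] moves
    the transpose away, so [h] itself may be arbitrary. *)
Lemma traceE (h : atlas M -> 'rV[R]_n -> 'M[R]_n) i x : chart_cod i x ->
  trace g h i x = \tr (invmx (g i x) *m h i x).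
Proof.
move=> ix; rewrite -mxtrace_tr trmx_mul trmx_inv Defs.metric_sym // mxtrace_mulC.
rewrite /trace /mxtrace; apply: eq_bigr => a _; rewrite mxE.
by apply: eq_bigr => b _; rewrite mxE.
Qed.

Lemma trace_lie_transform i j x : overlap i j x ->
  trace g Lg i x = trace g Lg j (transition i j x).
Proof.
move=> o; have [ix _] := o; have jy := transition_in_cod o.
rewrite (traceE _ ix) (traceE _ jy) (lie_metric_transform o) (metric_transform _ o).
by rewrite trace_congruence ?jacobian_unitmx ?metric_unitmx.
Qed.

Lemma trace_lie_differentiable i x : chart_cod i x ->
  differentiable (trace g Lg i) x.
Proof.
move=> ix.
have dGh : mx_differentiable (fun y => invmx (g i y) *m Lg i y) x.
  apply: mx_differentiableM; last exact: lie_metric_differentiable.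
  apply: mx_differentiable_inv; last exact: metric_differentiable.
  by apply: filterS (chart_cod_nbhs ix) => y; exact: metric_unitmx.
have : differentiable (fun y => \tr (invmx (g i y) *m Lg i y)) x.
  by apply: differentiable_bigsum => a; exact: dGh.
apply: near_eq_differentiable; apply: filterS (chart_cod_nbhs ix) => y iy.
by rewrite traceE.
Qed.

(** The product rule and the derivative of the inverse reduce this to [trace_lie_product].
    [lie_derivativeE] serves twice, for the Lie derivative of [g] and for that of [Lg]. *)
Lemma derive_trace_lie i x : chart_cod i x ->
  'D_(xi i x) (trace g Lg i) x = trace g (lie_derivative xi Lg) i x
    - \tr (invmx (g i x) *m Lg i x *m invmx (g i x) *m Lg i x).
Proof.
move=> ix.
have uG : \forall y \near x, g i y \in unitmx.
  by apply: filterS (chart_cod_nbhs ix) => y; exact: metric_unitmx.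
have dG := metric_differentiable ix.
have dh := lie_metric_differentiable ix.
have dGi := mx_differentiable_inv uG dG.
rewrite (@near_eq_derive _ _ _ _ (fun y => \tr (invmx (g i y) *m Lg i y))).
  rewrite derive_trace; last exact: mx_differentiableM.
  rewrite mx_deriveM // mx_derive_inv // traceE // (lie_derivativeE dh).
  apply: trace_lie_product; first exact: metric_unitmx.
  exact: lie_derivativeE.
by apply: filterS (chart_cod_nbhs ix) => y iy; rewrite traceE.
Qed.

End TraceOfLieDerivative.

(** * The trace as a global function and its extrema *)

Section TraceOnManifold.
Context {R : realType} {n : nat} {M : manifold R n}.
Variables (g : riemannian_metric M) (xi : vector_field M).

Local Notation Lg := (lie_derivative xi g).

(** The chart around [p] is picked by choice; [trace_lieE] shows that any other chart at [p] gives
    the same value. *)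
Definition trace_lie (p : M) : R :=
  let i := sval (cid (atlas_cover p)) in trace g Lg i (chart i p).

Lemma trace_lieE (i : atlas M) (p : M) : chart_dom i p ->
  trace_lie p = trace g Lg i (chart i p).
Proof.
rewrite /trace_lie; case: cid => j /= jp ip.
have o : overlap j i (chart j p) by split; [exact: chart_in_cod|rewrite chartK].
by rewrite (trace_lie_transform _ _ o) /transition chartK.
Qed.

Lemma trace_lie_chart_inv (i : atlas M) x : chart_cod i x ->
  trace_lie (chart_inv i x) = trace g Lg i x.
Proof.
by move=> ix; rewrite (trace_lieE (chart_inv_in_dom ix)) chart_invK.
Qed.

Lemma trace_lie_continuous : continuous trace_lie.
Proof.
move=> p; have [i ip] := atlas_cover p.
have c : {for p, continuous (trace g Lg i \o chart i)}.
  apply: continuous_comp; first exact: chart_cts ip.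
  apply: differentiable_continuous; apply: trace_lie_differentiable.
  exact: chart_in_cod ip.
rewrite /continuous_at (trace_lieE ip); apply: cvg_trans c.
apply: near_eq_cvg; apply: filterS (chart_dom_nbhs ip) => q iq.
by rewrite /= (trace_lieE iq).
Qed.

Hypothesis tr0 : trace_free g (lie_derivative xi Lg).

(** For a trace-free second Lie derivative, the derivative of the trace along [xi] is minus the
    squared norm of [Lg], so [Lg] vanishes wherever this single derivative does. *)
Lemma derive_trace_lie_eq0 (i : atlas M) x : chart_cod i x ->
  'D_(xi i x) (trace g Lg i) x = 0 -> Lg i x = 0.
Proof.
move=> ix; rewrite derive_trace_lie // (tr0 ix) sub0r => /eqP.
rewrite oppr_eq0 => /eqP; apply: posdef_trace_sq_eq0.
- exact: Defs.metric_sym.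
- by move=> v; exact: metric_pos.
- exact: lie_metric_sym.
Qed.

Lemma trace_lie_extremum (p : M) :
  (forall q, trace_lie q <= trace_lie p) \/
  (forall q, trace_lie p <= trace_lie q) -> trace_lie p = 0.
Proof.
move=> ext; have [i ip] := atlas_cover p.
have ix := chart_in_cod ip; set x := chart i p in ix.
have near_ix := chart_cod_nbhs ix.
have dT : \forall y \near x, differentiable (trace g Lg i) y.
  by apply: filterS near_ix => y; exact: trace_lie_differentiable.
suff D0 : 'D_(xi i x) (trace g Lg i) x = 0.
  by rewrite (trace_lieE ip) (traceE _ _ ix) (derive_trace_lie_eq0 ix D0)
    mulmx0 mxtrace0.
have px : trace_lie p = trace g Lg i x by exact: trace_lieE.
case: ext => ext.
  apply: derive_local_max => //; apply: filterS near_ix => y iy.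
  by rewrite -px -(trace_lie_chart_inv iy).
(* A minimum is treated as a maximum of the opposite function. *)
apply: oppr_inj; rewrite oppr0 -deriveN; last first.
  exact/diff_derivable/trace_lie_differentiable.
apply: derive_local_max.
  by apply: filterS dT => y; exact: differentiableN.
apply: filterS near_ix => y iy.
by rewrite lerN2 -px -(trace_lie_chart_inv iy).
Qed.

Lemma trace_lie_eq0 (p : M) : compact [set: M] -> trace_lie p = 0.
Proof.
(* The extreme value theorem asks for a nonempty set, and [p] itself supplies the point. *)
move=> cM; have M0 : [set: M] !=set0 by exists p.
have cT : {within [set: M], continuous trace_lie}.
  exact/continuous_subspaceT/trace_lie_continuous.
have [a _ amax] := compact_EVT_max M0 cM cT.
have [b _ bmin] := compact_EVT_min M0 cM cT.
have inT q : q \in [set: M] by rewrite inE.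
have Ta : trace_lie a = 0 by apply: trace_lie_extremum; left=> q; exact: amax.
have Tb : trace_lie b = 0 by apply: trace_lie_extremum; right=> q; exact: bmin.
by apply/le_anti/andP; split; [rewrite -Ta amax|rewrite -Tb bmin].
Qed.

(** Once the trace is identically zero, its derivative along [xi] vanishes at every point, and
    [derive_trace_lie_eq0] applies everywhere instead of only at extrema. *)
Lemma trace_free_killing : compact [set: M] -> is_killing g xi.
Proof.
move=> cM i x ix; apply: (derive_trace_lie_eq0 ix).
rewrite -(derive_cst (0 : R) x (xi i x)); apply: near_eq_derive.
apply: filterS (chart_cod_nbhs ix) => y iy.
by rewrite -(trace_lie_chart_inv iy) trace_lie_eq0.
Qed.

End TraceOnManifold.

Theorem theorem2p12 (R : realType) (n : nat) (M : manifold R n)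
    (g : riemannian_metric M) (f : smooth_function M) (xi : vector_field M)
    (lambda mu : R) :
  compact [set: M] ->
  hyperbolic_yamabe_soliton g xi lambda mu ->
  is_gradient_of g xi f ->
  lambda != 0 ->
  trace_free g (lie_derivative xi (lie_derivative xi g)) ->
  divergence_free g (lie_derivative xi (lie_derivative xi g)) ->
  (2 < n)%N ->
  is_killing g xi.
Proof.
move=> cM _ _ _ tr0 _ _; exact: trace_free_killing.
Qed.
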